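(* For every $n\ge1$, the equivalence classes of diagonally symmetric placements of $2n$ non-attacking rooks on a $2n\times 2n$ board are in bijection with the $DIII$ $(n,n)$-clans. Consequently $\Delta_n=d_{2n}$, where $\Delta_n$ is the number of $DIII$ $(n,n)$-clans and $d_{2n}$ is the number of inequivalent diagonally symmetric placements of $2n$ non-attacking rooks on a $2n\times2n$ board.
   Context: A placement of $m$ non-attacking rooks on an $m\times m$ board has exactly one rook in each row and each column (a permutation matrix). It is diagonally symmetric if it is invariant under reflection across each of the two main diagonals of the board. Two placements are equivalent if some element of the dihedral group of order 8 (the symmetry group of the square board) transforms one into the other. An $(n,n)$-clan is a string $\gamma=c_1\cdots c_{2n}$ of symbols from $\mathbb N\cup\{+,-\}$ with equally many $+$'s and $-$'s, in which every natural number that appears appears exactly twice; two clans are equal if they have the same signs at the same positions and the same positions of matching number pairs. $rev(\gamma)=c_{2n}\cdots c_1$, and $\overline\gamma$ is obtained by exchanging $+$ and $-$. A $DIII$ $(n,n)$-clan is an $(n,n)$-clan such that (i) $\gamma=rev(\overline\gamma)$; (ii) if $c_i\in\mathbb N$ then $c_i\ne c_{2n+1-i}$; (iii) the number of $-$'s among $c_1,\dots,c_n$ plus the number of pairs $i<j\le n$ with $c_i=c_j\in\mathbb N$ is even. *)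

(* Defs.v *)
From HB Require Import structures.
From mathcomp Require Import all_boot all_fingroup cyclic.

Set Implicit Arguments.
Unset Strict Implicit.
Unset Printing Implicit Defensive.

(* A placement is the set of its occupied cells. *)

Definition cell (m : nat) : finType := ('I_m * 'I_m)%type.

Definition is_placement (m : nat) (P : {set cell m}) : bool :=
  [forall i, #|[set j | (i, j) \in P]| == 1]
  && [forall j, #|[set i | (i, j) \in P]| == 1].

Definition diag_flip (m : nat) (x : cell m) : cell m := (x.2, x.1).
Definition antidiag_flip (m : nat) (x : cell m) : cell m :=
  (rev_ord x.2, rev_ord x.1).
Definition quarter_turn (m : nat) (x : cell m) : cell m := (x.2, rev_ord x.1).

Lemma diag_flip_inj (m : nat) : injective (@diag_flip m).
Proof. by move=> [i j] [k l] [-> ->]. Qed.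

Lemma quarter_turn_inj (m : nat) : injective (@quarter_turn m).
Proof.
apply: (can_inj (g := fun x => (rev_ord x.2, x.1))) => -[i j].
by rewrite /= rev_ordK.
Qed.

(* The group generated by a reflection and a quarter turn; it has order 8
   for m > 1 (card_board_group). *)
Definition board_group (m : nat) : {group {perm cell m}} :=
  <<[set perm (@diag_flip_inj m); perm (@quarter_turn_inj m)]>>%G.

Lemma card_board_group (m : nat) : 1 < m -> #|board_group m| = 8.
Proof.
case: m => [//|m] m1; rewrite /board_group /=.
set s := perm (@diag_flip_inj _); set r := perm (@quarter_turn_inj _).
have z : @ord0 m <> rev_ord ord0.
  by move=> /(congr1 val) /=; rewrite subn1 /= => e; move: m1; rewrite -e.
have s2 : (s ^+ 2 = 1)%g by apply/permP => -[i j]; rewrite permM !permE.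
have r4 : (r ^+ 4 = 1)%g.
  by apply/permP => -[i j]; rewrite !permM !permE /= /quarter_turn /= !rev_ordK.
have ord_s : #[s]%g = 2.
  apply: nt_prime_order => //; apply/eqP => /permP/(_ (ord0, rev_ord ord0)).
  by rewrite perm1 permE => /(congr1 snd) /= /z.
have ord_r : #[r]%g = 4.
  have := r4; move/eqP; rewrite -order_dvdn => d4.
  have: ~~ (#[r]%g %| 2).
    rewrite order_dvdn; apply/eqP => /permP/(_ (ord0, ord0)).
    by rewrite permM perm1 !permE => /(congr1 fst) /= /esym/z.
  by have := dvdn_leq _ d4; move: d4; case: #[r]%g => [|[|[|[|[|k]]]]] // _ /(_ isT).
have nrs : s \in 'N(<[r]>)%g.
  have rs : (r ^ s = r^-1)%g.
    apply/(mulgI r); rewrite mulgV /conjg.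
    have -> : (s^-1 = s)%g by apply/(mulgI s); rewrite mulgV -[in RHS]expg2.
    by apply/permP => -[i j]; rewrite !permM !permE /= /diag_flip /quarter_turn /= rev_ordK.
  by rewrite inE -cycleJ rs cycleV.
have -> : <<[set s; r]>>%g = (<[r]> <*> <[s]>)%g.
  by rewrite joing_idl joing_idr setUC.
rewrite norm_joinEr ?cycle_subG // TI_cardMg -?orderE ?ord_s ?ord_r //.
rewrite setIC; apply: prime_TIg; rewrite -?orderE ?ord_s // cycle_subG.
apply/negP => sr; have /permP/(_ (ord0, ord0)) : (s * r = r * s)%g.
  by case/cycleP: sr => k ->; rewrite -expgSr -expgS.
by rewrite !permM !permE => /(congr1 fst) /= /z.
Qed.

Definition diag_symmetric (m : nat) (P : {set cell m}) : bool :=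
  (@diag_flip m @: P == P) && (@antidiag_flip m @: P == P).

Definition diag_placements (m : nat) : {set {set cell m}} :=
  [set P | is_placement P && diag_symmetric P].

Definition placement_equiv (m : nat) : rel {set cell m} :=
  fun P Q => [exists g in board_group m, g @: P == Q].

Definition diag_classes (m : nat) : {set {set {set cell m}}} :=
  equivalence_partition (@placement_equiv m) (diag_placements m).

Definition num_diag_classes (m : nat) : nat := #|diag_classes m|.

Inductive symbol := Num of nat | Plus | Minus.

Definition sum_of_symbol (c : symbol) : nat + bool :=
  match c with Num k => inl k | Plus => inr true | Minus => inr false end.
Definition symbol_of_sum (s : nat + bool) : symbol :=
  match s with inl k => Num k | inr b => if b then Plus else Minus end.
Lemma sum_of_symbolK : cancel sum_of_symbol symbol_of_sum.
Proof. by case. Qed.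
HB.instance Definition _ := Countable.copy symbol (can_type sum_of_symbolK).

Definition is_num (c : symbol) : bool := if c is Num _ then true else false.
Definition sign (c : symbol) : option symbol :=
  if is_num c then None else Some c.
Definition opp_symbol (c : symbol) : symbol :=
  match c with Num k => Num k | Plus => Minus | Minus => Plus end.

Section Clan.
Variable n : nat.
Implicit Types s t : n.*2.-tuple symbol.

Definition is_clan s : bool :=
  (count_mem Plus s == count_mem Minus s)
  && all (fun c => is_num c ==> (count_mem c s == 2)) s.

Definition matched s (i j : 'I_n.*2) : bool :=
  [&& i != j, is_num (tnth s i) & tnth s i == tnth s j].

Definition same_clan s t : bool :=
  [forall i, sign (tnth s i) == sign (tnth t i)]
  && [forall i, forall j, matched s i j == matched t i j].

Definition rev_opp s : n.*2.-tuple symbol := [tuple of rev (map opp_symbol s)].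

(* Positions are numbered from 0, so the mirror position 2n+1-i is rev_ord i
   and the first half is i < n. *)
Definition is_DIII s : bool :=
  [&& same_clan s (rev_opp s),
      [forall i, is_num (tnth s i) ==> (tnth s i != tnth s (rev_ord i))]
    & ~~ odd (count_mem Minus (take n s)
              + #|[set p : 'I_n.*2 * 'I_n.*2 |
                   (p.1 < p.2 < n) && matched s p.1 p.2]|)].

Definition clan_string := {s : n.*2.-tuple symbol | is_clan s}.

Definition clan_eq : rel clan_string := fun x y => same_clan (val x) (val y).

Lemma same_clanP s t :
  reflect ((forall i, sign (tnth s i) = sign (tnth t i))
           /\ (forall i j, matched s i j = matched t i j))
          (same_clan s t).
Proof.
apply: (iffP andP) => [[/forallP A /forallP B]|[A B]]; split.
- by move=> i; apply/eqP.
- by move=> i j; apply/eqP; move/forallP: (B i).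
- by apply/forallP => i; apply/eqP.
- by apply/forallP => i; apply/forallP => j; apply/eqP.
Qed.

Lemma same_clan_refl : reflexive same_clan.
Proof. by move=> s; apply/same_clanP. Qed.

Lemma same_clan_sym : symmetric same_clan.
Proof.
by move=> s t; apply/same_clanP/same_clanP => -[A B]; split=> *;
  rewrite ?A ?B.
Qed.

Lemma same_clan_trans : transitive same_clan.
Proof.
by move=> t s u /same_clanP[A B] /same_clanP[C D]; apply/same_clanP;
  split=> *; rewrite ?A ?B.
Qed.

Lemma clan_eq_refl : reflexive clan_eq.
Proof. by move=> s; apply: same_clan_refl. Qed.
Lemma clan_eq_sym : symmetric clan_eq.
Proof. by move=> s t; apply: same_clan_sym. Qed.
Lemma clan_eq_trans : transitive clan_eq.
Proof. by move=> t s u; apply: same_clan_trans. Qed.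

Canonical clan_equiv := EquivRel clan_eq clan_eq_refl clan_eq_sym clan_eq_trans.

Definition clan := {eq_quot clan_eq}%qT.
HB.instance Definition _ := Choice.on clan.

Definition clan_repr (c : clan) : n.*2.-tuple symbol :=
  val (generic_quotient.repr c).

Lemma tnth_rev_opp s i : tnth (rev_opp s) i = opp_symbol (tnth s (rev_ord i)).
Proof.
rewrite (tnth_nth Plus) /= nth_rev ?size_map ?size_tuple //.
by rewrite (nth_map Plus) ?size_tuple ?ltn_subrL ?(tnth_nth Plus) //=;
  case: (n) i => [[]|].
Qed.

Lemma is_num_sign c d : sign c = sign d -> is_num c = is_num d.
Proof. by case: c; case: d. Qed.

Lemma matched_rev_opp s i j :
  matched (rev_opp s) i j = matched s (rev_ord i) (rev_ord j).
Proof.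
rewrite /matched !tnth_rev_opp (inj_eq rev_ord_inj).
by case: (tnth s (rev_ord i)) => [k||]; case: (tnth s (rev_ord j)).
Qed.

Lemma same_clan_rev_opp s t : same_clan s t -> same_clan (rev_opp s) (rev_opp t).
Proof.
case/same_clanP=> A B; apply/same_clanP; split=> [i|i j].
  rewrite !tnth_rev_opp; move: (A (rev_ord i)).
  by case: (tnth s _) => [?||]; case: (tnth t _).
by rewrite !matched_rev_opp B.
Qed.

Lemma rev_ord_neq (i : 'I_n.*2) : i != rev_ord i.
Proof.
apply/eqP => /(congr1 val) /= e.
have /(congr1 odd) : i + i.+1 = n.*2 by rewrite {1}e subnK.
by rewrite addnS /= oddD addbb odd_double.
Qed.

(* is_DIII depends only on the clan, not on the chosen labels. *)
Lemma is_DIII_same_clan s t : same_clan s t -> is_DIII s = is_DIII t.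
Proof.
move=> st; have /same_clanP[A B] := st; rewrite /is_DIII; congr [&& _, _ & _].
- apply/idP/idP => h.
    apply: (same_clan_trans _ (same_clan_rev_opp st)).
    by apply: same_clan_trans h; rewrite same_clan_sym.
  apply: (same_clan_trans st); apply: (same_clan_trans h).
  by rewrite same_clan_sym same_clan_rev_opp.
- apply: eq_forallb => i; have := B i (rev_ord i).
  rewrite /matched rev_ord_neq -(is_num_sign (A i)) /=.
  by case: is_num => //= ->.
- congr (~~ odd (_ + _)); last first.
    by apply: eq_card => p; rewrite !inE B.
  have cE (u : seq symbol) : count_mem Minus u = count_mem (Some Minus) (map sign u).
    by rewrite count_map; apply: eq_count => -[].
  rewrite !cE !map_take; congr (count _ (take _ _)).
  apply: (@eq_from_nth _ None); rewrite ?size_map ?size_tuple // => i lti.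
  rewrite !(nth_map Plus) ?size_tuple //.
  by have := A (Ordinal lti); rewrite !(tnth_nth Plus).
Qed.

(* Every clan has a representative whose labels are at most 2n, which makes
   clan a finite type. *)
Definition clan_code (c : clan) : n.*2.-tuple ('I_n.*2.+1 + bool) :=
  let s := clan_repr c in
  [tuple of map (fun x => match x with
                          | Num _ => inl (inord (index x s))
                          | Plus => inr true
                          | Minus => inr false end) s].

Definition clan_decode (u : n.*2.-tuple ('I_n.*2.+1 + bool)) : option clan :=
  omap (\pi_clan)%qT
    (insub [tuple of map (fun x => symbol_of_sum match x with
                                   | inl k => inl (val k)
                                   | inr b => inr b end) u]).

Lemma clan_codeK : pcancel clan_code clan_decode.
Proof.
move=> c; rewrite /clan_decode /clan_code /clan_repr.
set s := generic_quotient.repr c; set v := [tuple of _].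
pose h x := if x is Num _ then Num (index x (val s)) else x.
have vE : v = [tuple of map h (val s)].
  apply: val_inj; rewrite /= -map_comp; apply/eq_in_map => -[k||] xs //=.
  by rewrite inordK // ltnS -[X in _ <= X](size_tuple (val s)) index_size.
have hI : {in val s &, injective h}.
  move=> [k||] [l||] //= xs ys [] /(congr1 (nth Plus (val s))).
  by rewrite !nth_index.
have hs x : h x \in map h (val s) -> is_num (h x) = is_num x by case: x.
have cnt x : x \in val s -> count_mem (h x) (map h (val s)) = count_mem x (val s).
  by move=> xs; rewrite count_map; apply: eq_in_count => y ys /=;
    apply/eqP/eqP => [/hI ->|->].
have cl : is_clan v.
  case/andP: (valP s) => [/eqP cpm /allP al]; rewrite vE /is_clan /=.
  have cs b : b = Plus \/ b = Minus -> count_mem b (map h (val s)) = count_mem b (val s).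
    by move=> bE; rewrite count_map; apply: eq_count => y /=;
      case: bE => ->; case: y.
  rewrite !cs ?cpm ?eqxx /=; [|by right|by left].
  apply/allP => _ /mapP[x xs ->]; rewrite cnt //; apply/implyP => hx.
  by move: (al x xs); move: hx; case: (x).
rewrite insubT /=; congr Some.
have -> : c = (\pi_clan s)%qT by rewrite reprK.
apply/eqP; rewrite eqmodE /= /clan_eq /= vE; apply/same_clanP; split=> [i|i j].
  by rewrite tnth_map; case: (tnth _ i).
rewrite /matched !tnth_map (inj_in_eq hI) ?mem_tnth //.
by case: (tnth _ i).
Qed.

HB.instance Definition _ : isCountable clan := PCanIsCountable clan_codeK.
HB.instance Definition _ : isFinite clan := PCanIsFinite clan_codeK.

Definition DIII_clans : {set clan} := [set c : clan | is_DIII (clan_repr c)].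

Definition num_DIII_clans : nat := #|DIII_clans|.

End Clan.

(* Main.v *)
(* Diagonally symmetric placements are the graphs of the involutions of the
   2n positions that commute with the reversal w; a quarter turn replaces such
   an involution f by w f, which never equals f, so every class has exactly two
   elements. A DIII clan without the parity condition is also such an involution:
   a sign tells whether f fixes a position or sends it to its mirror image.
   Replacing f by w f on the single orbit of the first position under f and w,
   and keeping f elsewhere, changes the parity in condition (iii), so exactly
   half of the involutions give DIII clans. The resulting bijection is not the
   map sending a placement class to a clan in it: for n = 2 the clans ++-- and
   --++ are both even but belong to the same class. *)
Require Import Defs.
From HB Require Import structures.
From mathcomp Require Import all_boot all_fingroup.
From mathcomp Require Import zify.

Set Implicit Arguments.
Unset Strict Implicit.
Unset Printing Implicit Defensive.

(** Sends an element to the one with the same rank in the other type; the bijection of the theorem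
    comes from equal cardinalities in this way. *)
Lemma bijective_of_eq_card (T U : finType) :
  #|T| = #|U| -> exists f : T -> U, bijective f.
Proof.
move=> e; exists (fun x => enum_val (cast_ord e (enum_rank x))).
exists (fun y => enum_val (cast_ord (esym e) (enum_rank y))) => x.
  by rewrite enum_valK cast_ordK enum_rankK.
by rewrite enum_valK cast_ordKV enum_rankK.
Qed.

(** * Symmetric placements as involutions *)

Definition rev_involutions (m : nat) : {set {ffun 'I_m -> 'I_m}} :=
  [set f : {ffun 'I_m -> 'I_m} | [forall i, f (f i) == i]
           && [forall i, f (rev_ord i) == rev_ord (f i)]].

Lemma rev_involutionsP m (f : {ffun 'I_m -> 'I_m}) :
  reflect ((forall i, f (f i) = i) /\ (forall i, f (rev_ord i) = rev_ord (f i)))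
          (f \in rev_involutions m).
Proof.
rewrite inE; apply: (iffP andP) => [[/forallP A /forallP B]|[A B]]; split.
- by move=> i; apply/eqP.
- by move=> i; apply/eqP.
- by apply/forallP => i; apply/eqP.
- by apply/forallP => i; apply/eqP.
Qed.

Definition graph m (f : {ffun 'I_m -> 'I_m}) : {set cell m} :=
  [set x : cell m | x.2 == f x.1].

Lemma graph_inj m : injective (@graph m).
Proof.
move=> f g /setP e; apply/ffunP => i; move: (e (i, f i)).
by rewrite !inE /= eqxx => /esym/eqP.
Qed.

Lemma imset_graph_involution m (h : cell m -> cell m) (P : {set cell m}) :
  involutive h -> (h @: P == P) = [forall x, (h x \in P) == (x \in P)].
Proof.
move=> hK; apply/eqP/forallP => [e x|e].
  by rewrite -{1}e mem_imset //; apply: inv_inj.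
apply/setP => x; rewrite -{1}(hK x) mem_imset; last exact: inv_inj.
exact/eqP.
Qed.

Lemma involutive_eq_sym (T : eqType) (f : T -> T) x y :
  involutive f -> (y == f x) = (x == f y).
Proof. by move=> fK; rewrite eq_sym (can2_eq fK fK). Qed.

(** The row condition makes the placement the graph of a function [f]. The diagonal flip transposes
    the graph, which forces [f] to be an involution; the antidiagonal flip then forces [f] to
    commute with [rev_ord]. *)
Lemma diag_placementsE m : diag_placements m = (@graph m) @: rev_involutions m.
Proof.
have diagK : involutive (@diag_flip m) by case.
have antiK : involutive (@antidiag_flip m).
  by move=> [i j]; rewrite /antidiag_flip /= !rev_ordK.
apply/setP => P; rewrite inE /is_placement /diag_symmetric !imset_graph_involution //.
apply/idP/imsetP => [/andP[/andP[/forallP row _] /andP[/forallP sy /forallP asy]]|].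
  have /fin_all_exists[f fP] i : exists j, forall k, ((i, k) \in P) = (k == j).
    by have /cards1P[j /setP e] := row i; exists j => k; move: (e k); rewrite !inE.
  exists (finfun f).
    apply/rev_involutionsP; split=> i; apply/eqP; rewrite !ffunE.
      by rewrite eq_sym -fP; rewrite -(eqP (sy _)) fP /=.
    rewrite eq_sym -fP -[X in X \in P]/(antidiag_flip (f i, i)).
    by rewrite (eqP (asy _)) -(eqP (sy _)) fP /=.
  by apply/setP => -[i j]; rewrite inE /= ffunE fP.
move=> [f /rev_involutionsP[fK fR] ->]; apply/andP; split; apply/andP; split.
- apply/forallP => i; apply/cards1P; exists (f i); apply/setP => j.
  by rewrite !inE.
- apply/forallP => j; apply/cards1P; exists (f j); apply/setP => i.
  by rewrite !inE /= involutive_eq_sym.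
- by apply/forallP => -[i j]; rewrite !inE /= involutive_eq_sym.
- apply/forallP => -[i j]; rewrite !inE /= fR (inj_eq rev_ord_inj).
  by rewrite involutive_eq_sym.
Qed.

(** * Equivalence classes of placements *)

Definition rev_comp m (f : {ffun 'I_m -> 'I_m}) : {ffun 'I_m -> 'I_m} :=
  [ffun i => rev_ord (f i)].

Lemma rev_compK m : involutive (@rev_comp m).
Proof. by move=> f; apply/ffunP => i; rewrite !ffunE rev_ordK. Qed.

Lemma rev_comp_in m (f : {ffun 'I_m -> 'I_m}) :
  f \in rev_involutions m -> rev_comp f \in rev_involutions m.
Proof.
move=> /rev_involutionsP[fK fR]; apply/rev_involutionsP.
by split=> i; rewrite !ffunE fR ?fK ?rev_ordK.
Qed.

Lemma diag_flip_graph m (f : {ffun 'I_m -> 'I_m}) : f \in rev_involutions m ->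
  perm (@diag_flip_inj m) @: graph f = graph f.
Proof.
move=> /rev_involutionsP[fK fR]; apply/setP => -[i j].
rewrite -[(i, j)]/(diag_flip (j, i)) -(permE (@diag_flip_inj m)).
rewrite mem_imset; last exact: perm_inj.
by rewrite permE !inE /= involutive_eq_sym.
Qed.

Lemma quarter_turn_graph m (f : {ffun 'I_m -> 'I_m}) : f \in rev_involutions m ->
  perm (@quarter_turn_inj m) @: graph f = graph (rev_comp f).
Proof.
move=> /rev_involutionsP[fK fR]; apply/setP => -[i j].
have -> : (i, j) = perm (@quarter_turn_inj m) (rev_ord j, i).
  by rewrite permE /quarter_turn /= rev_ordK.
rewrite mem_imset; last exact: perm_inj.
rewrite permE !inE /quarter_turn /= ffunE rev_ordK fR.
by apply: (@involutive_eq_sym _ (fun i => rev_ord (f i))) => k; rewrite fR fK rev_ordK.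
Qed.

(** Stability need only be checked on generators: the diagonal flip fixes both graphs and the
    quarter turn exchanges them. So the orbit stays in the pair, and the identity and the quarter
    turn reach both members. *)
Lemma placement_equiv_graph m (f : {ffun 'I_m -> 'I_m}) Q : f \in rev_involutions m ->
  placement_equiv (graph f) Q = (Q \in [set graph f; graph (rev_comp f)]).
Proof.
move=> fS; have gS := rev_comp_in fS.
set A := [set _; _].
have actE (R : {set cell m}) g : ('P^*)%act R g = g @: R by exact: eq_imset.
have stable : board_group m \subset 'N(A | 'P^*)%g.
  rewrite gen_subG; apply/subsetP => g; rewrite !inE => /orP[]/eqP -> /=;
  apply/subsetP => R; rewrite !inE => /orP[]/eqP ->; rewrite actE.
  - by rewrite diag_flip_graph ?eqxx.
  - by rewrite diag_flip_graph ?eqxx ?orbT.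
  - by rewrite quarter_turn_graph ?eqxx ?orbT.
  - by rewrite quarter_turn_graph // rev_compK eqxx.
apply/existsP/idP => [[g /andP[gB /eqP <-]]|].
  have := astabs_act (graph f) (subsetP stable g gB).
  by rewrite actE => ->; rewrite !inE eqxx.
rewrite !inE => /orP[]/eqP ->.
  by exists 1%g; rewrite group1 -{2}[graph f]imset_id; apply/eqP/eq_imset => x; rewrite perm1.
exists (perm (@quarter_turn_inj m)); rewrite quarter_turn_graph // eqxx andbT.
by apply: mem_gen; rewrite !inE eqxx orbT.
Qed.

Lemma card_rev_involutions (n : nat) : 0 < n ->
  #|rev_involutions n.*2| = num_diag_classes n.*2 * 2.
Proof.
move=> n0; rewrite -(card_imset _ (@graph_inj _)) -diag_placementsE.
apply: card_uniform_partition; last first.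
  apply: equivalence_partitionP => P Q R; rewrite diag_placementsE.
  move=> /imsetP[f fS ->] /imsetP[g gS ->] /imsetP[h hS ->].
  rewrite !placement_equiv_graph // !inE eqxx !(inj_eq (@graph_inj _)); split=> //.
  by move=> /orP[]/eqP ->; rewrite ?rev_compK // orbC.
move=> C /imsetP[P]; rewrite diag_placementsE => /imsetP[f fS ->] ->.
have -> : [set y in [set graph f | f in rev_involutions n.*2] | placement_equiv (graph f) y]
   = [set graph f; graph (rev_comp f)].
  apply/setP => Q; rewrite inE placement_equiv_graph // andb_idl //.
  rewrite !inE => /orP[]/eqP ->; rewrite mem_imset ?rev_comp_in //; exact: graph_inj.
(* The two graphs differ because a board of even size has no position fixed by [rev_ord]. *)
rewrite cards2 (inj_eq (@graph_inj _)); case: eqP => // /ffunP.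
have m0 : 0 < n.*2 by rewrite double_gt0.
by move=> /(_ (Ordinal m0)); rewrite ffunE => /eqP; rewrite (negPf (rev_ord_neq _)).
Qed.

(** * Toggling one orbit, and its effect on parity *)

Definition rev_orbit m (f : {ffun 'I_m -> 'I_m}) (z : 'I_m) : pred 'I_m :=
  [pred i | [|| i == z, i == rev_ord z, i == f z | i == rev_ord (f z)]].

Definition toggle m (z : 'I_m) (f : {ffun 'I_m -> 'I_m}) : {ffun 'I_m -> 'I_m} :=
  [ffun i => if rev_orbit f z i then rev_ord (f i) else f i].

(** Toggling exchanges [f z] and [rev_ord (f z)], which only permutes the four listed points. Hence
    a second toggle acts on the same orbit and undoes the first. *)
Lemma toggle_orbit m (z : 'I_m) (f : {ffun 'I_m -> 'I_m}) :
  rev_orbit (toggle z f) z =1 rev_orbit f z.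
Proof.
move=> i; rewrite /rev_orbit /= ffunE /rev_orbit /= eqxx /= rev_ordK.
by congr [|| _, _ | _]; rewrite orbC.
Qed.

Lemma toggleK m (z : 'I_m) : involutive (toggle z).
Proof.
move=> f; apply/ffunP => i; rewrite [LHS]ffunE toggle_orbit ffunE.
by case: (rev_orbit f z i); rewrite ?rev_ordK.
Qed.

(** The orbit is closed under [f] and [rev_ord], so the two pieces of the toggled map do not
    interfere. *)
Lemma toggle_in m (z : 'I_m) (f : {ffun 'I_m -> 'I_m}) :
  f \in rev_involutions m -> toggle z f \in rev_involutions m.
Proof.
move=> /rev_involutionsP[fK fR].
have ER i : rev_orbit f z (rev_ord i) = rev_orbit f z i.
  rewrite /rev_orbit /= !(can2_eq rev_ordK rev_ordK) !rev_ordK.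
  by case: (i == z); case: (i == rev_ord z); case: (i == f z); case: (i == rev_ord (f z)).
have Ef i : rev_orbit f z (f i) = rev_orbit f z i.
  rewrite /rev_orbit /= !(can2_eq fK fK) !fR !fK.
  by case: (i == z); case: (i == rev_ord z); case: (i == f z); case: (i == rev_ord (f z)).
apply/rev_involutionsP; split=> i; rewrite !ffunE ?ER.
  by case Oi: (rev_orbit f z i); rewrite ?ER Ef Oi ?fR ?fK ?rev_ordK.
by case: ifP; rewrite fR.
Qed.

Section Parity.
Variable n : nat.
Implicit Type f : {ffun 'I_n.*2 -> 'I_n.*2}.

Lemma rev_ord_lt_half (i : 'I_n.*2) : (rev_ord i < n) = ~~ (i < n).
Proof. by have := ltn_ord i; rewrite /=; lia. Qed.

(* The clan of [f] has a minus at [i < n] in the first case, and a matched pair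
   [i < f i] within the first half in the second. *)
Definition odd_witness f : {set 'I_n.*2} :=
  [set i : 'I_n.*2 | (i < n) && ((f i == rev_ord i) || (i < f i < n))].

Definition even_rev_involutions : {set {ffun 'I_n.*2 -> 'I_n.*2}} :=
  [set f in rev_involutions n.*2 | ~~ odd #|odd_witness f|].

Lemma odd_witness_toggle (z : 'I_n.*2) f : f \in rev_involutions n.*2 -> z = 0 :> nat ->
  odd #|odd_witness (toggle z f)| = ~~ odd #|odd_witness f|.
Proof.
move=> /rev_involutionsP[fK fR] z0; have m0 := ltn_ord z; have n0 : 0 < n by lia.
rewrite [in LHS](cardsD1 z) [in RHS](cardsD1 z) !oddD.
(* Any other orbit point in the first half is sent to the first or the last position, before and
   after toggling, so it is never a witness. *)
have -> : odd_witness (toggle z f) :\ z = odd_witness f :\ z.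
  apply/setP => i; rewrite !inE ffunE; case: ifP => // /or4P[]/eqP e.
  - by rewrite e eqxx.
  - by rewrite e rev_ord_lt_half z0 n0 !andbF.
  - have -> : f i = z by rewrite e fK.
    rewrite -!val_eqE /=; have := ltn_ord i; lia.
  - have -> : f i = rev_ord z by rewrite e fR fK.
    rewrite -!val_eqE /=; have := ltn_ord i; lia.
(* At [z = 0] the witness condition says that [f z] is the last position or lies strictly between
   [0] and [n]; [rev_ord] maps these values onto the complementary ones. *)
rewrite -addNb; congr addb; rewrite !oddb !inE ffunE /rev_orbit /= eqxx /=.
have := ltn_ord (f z); rewrite -!val_eqE /=; lia.
Qed.

Lemma card_even_rev_involutions : 0 < n ->
  #|rev_involutions n.*2| = #|even_rev_involutions| * 2.
Proof.
move=> n0; have m0 : 0 < n.*2 by rewrite double_gt0.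
pose z := Ordinal m0; set S := rev_involutions _.
rewrite -(cardsID [set f | ~~ odd #|odd_witness f|]) muln2 -[RHS]addnn.
have -> : S :&: [set f | ~~ odd #|odd_witness f|] = even_rev_involutions.
  by apply/setP => f; rewrite !inE.
(* The toggle at the first position carries the odd involutions bijectively onto the even ones. *)
congr (_ + _); rewrite -(card_imset _ (inv_inj (toggleK z))).
apply: eq_card => f; rewrite -[f in LHS](toggleK z) mem_imset; last exact: inv_inj (toggleK z).
have tS : (toggle z f \in S) = (f \in S).
  by apply/idP/idP => /(toggle_in z); rewrite ?toggleK.
rewrite in_setD tS [RHS]inE inE -/S; case fS: (f \in S); rewrite ?andbF //=.
by rewrite odd_witness_toggle // andbT negbK.
Qed.

End Parity.

(** * From clans to involutions *)

Lemma count_mem_take (T : eqType) m (s : m.-tuple T) (x : T) k : k <= m ->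
  count_mem x (take k s) = #|[set j : 'I_m | (j < k) && (tnth s j == x)]|.
Proof.
move=> km; rewrite -sum1_count (big_nth x) size_takel ?size_tuple // big_mkord.
rewrite (big_ord_widen_cond _ (fun i => nth x (take k s) i == x) (fun=> 1) km).
rewrite sum1dep_card; apply: eq_card => j; rewrite !inE andbC.
by case: ltnP => //= jk; rewrite nth_take // (tnth_nth x).
Qed.

Lemma count_mem_tuple (T : eqType) m (s : m.-tuple T) (x : T) :
  count_mem x s = #|[set j : 'I_m | tnth s j == x]|.
Proof.
rewrite -{1}(take_size s) size_tuple count_mem_take //.
by apply: eq_card => j; rewrite !inE ltn_ord.
Qed.

Section ClanInvolution.
Variable n : nat.
Implicit Types (s t : n.*2.-tuple symbol) (f : {ffun 'I_n.*2 -> 'I_n.*2}).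

(** A DIII clan with condition (iii) dropped; up to relabelling, these correspond to all of
    [rev_involutions]. *)
Definition mirror_clan s : Prop :=
  [/\ is_clan s, same_clan s (rev_opp s) &
      forall i, is_num (tnth s i) -> tnth s i != tnth s (rev_ord i)].

(* Matched positions are exchanged, and a sign [+] (resp. [-]) in the first half
   makes the position and its mirror image fixed (resp. exchanged). *)
Definition clan_involution s : {ffun 'I_n.*2 -> 'I_n.*2} :=
  [ffun i => if is_num (tnth s i) then odflt i [pick j | matched s i j]
             else if (tnth s i == Plus) == (i < n) then i else rev_ord i].

Lemma matched_sym s i j : matched s i j = matched s j i.
Proof.
rewrite /matched eq_sym.
by have [->|] := eqVneq (tnth s i) (tnth s j); rewrite ?andbF.
Qed.

(** A label of a clan occurs exactly twice, so removing [i] from its positions leaves a single one,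
    which [pick] must find. *)
Lemma matched_clan s i j : is_clan s ->
  matched s i j = is_num (tnth s i) && (clan_involution s i == j).
Proof.
move=> /andP[_ /allP/(_ _ (mem_tnth i s))].
rewrite ffunE /matched count_mem_tuple; case: (is_num _) => /=; last by rewrite andbF.
move=> c2; have /cards1P[k /setP kP] :
    #|[set j | tnth s j == tnth s i] :\ i| == 1.
  by move: c2; rewrite [X in X == 2 -> _](cardsD1 i) inE eqxx.
have kE l : (i != l) && (tnth s i == tnth s l) = (l == k).
  by have := kP l; rewrite !inE eq_sym [tnth s l == _]eq_sym.
rewrite kE; case: pickP => [l|/(_ k)]; rewrite kE ?eqxx // => /eqP ->.
exact: eq_sym.
Qed.

Lemma mirror_clan_sign s i : mirror_clan s ->
  sign (tnth s (rev_ord i)) = sign (opp_symbol (tnth s i)).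
Proof.
by case=> _ /same_clanP[/(_ (rev_ord i)) + _] _; rewrite tnth_rev_opp rev_ordK.
Qed.

Lemma mirror_clan_num s i : mirror_clan s -> is_num (tnth s (rev_ord i)) = is_num (tnth s i).
Proof. by move=> /(mirror_clan_sign i); case: (tnth s i); case: (tnth s _). Qed.

Lemma clan_involution_in s : mirror_clan s -> clan_involution s \in rev_involutions n.*2.
Proof.
move=> sDI; have [cs /same_clanP[_ mR] _] := sDI.
have mR' i j : matched s (rev_ord i) (rev_ord j) = matched s i j.
  by rewrite [RHS]mR matched_rev_opp.
have FR i : clan_involution s (rev_ord i) = rev_ord (clan_involution s i).
  have [si|si] := boolP (is_num (tnth s i)).
    have := matched_clan i (clan_involution s i) cs.
    rewrite si eqxx -mR' matched_clan // => /andP[_ /eqP //].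
  (* At a sign, passing to the mirror position flips both the sign and the half, so the test for
     being fixed gives the same answer. *)
  rewrite !ffunE mirror_clan_num // (negPf si) rev_ord_lt_half.
  have := mirror_clan_sign i sDI; move: si.
  by case: (tnth s i) => // _; case: (tnth s _) => // _; case: (i < n); rewrite /= ?rev_ordK.
apply/rev_involutionsP; split=> // i.
have [si|si] := boolP (is_num (tnth s i)).
  have := matched_clan i (clan_involution s i) cs.
  by rewrite si eqxx matched_sym matched_clan // => /andP[_ /eqP].
have [e|e] : clan_involution s i = i \/ clan_involution s i = rev_ord i.
  by rewrite ffunE (negPf si); case: ifP; [left|right].
  by rewrite !e.
by rewrite e FR e rev_ordK.
Qed.

(** Condition (ii) keeps a partner away from the mirror position, so the involution alone tells
    numbers from signs. This makes the clan recoverable from it. *)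
Lemma is_num_clan_involution s i : mirror_clan s ->
  is_num (tnth s i) = (clan_involution s i != i) && (clan_involution s i != rev_ord i).
Proof.
move=> [cs _ /(_ i) sR]; have := matched_clan i (clan_involution s i) cs.
have [si|si] := boolP (is_num (tnth s i)).
  rewrite eqxx => /and3P[ne _ /eqP e]; rewrite eq_sym ne; apply/esym.
  by apply: contra (sR si) => /eqP e'; rewrite e e'.
by move=> _; rewrite ffunE (negPf si); case: ifP; rewrite eqxx ?andbF.
Qed.

Lemma sign_clan_involution s i :
  sign (tnth s i) = if is_num (tnth s i) then None
                    else if (clan_involution s i == i) == (i < n) then Some Plus
                    else Some Minus.
Proof.
have := rev_ord_neq i; rewrite eq_sym => /negPf iR.
by rewrite ffunE; case: (tnth s i) => //=; case: (i < n); rewrite ?eqxx ?iR.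
Qed.

Lemma same_clan_involution s t : mirror_clan s -> mirror_clan t ->
  same_clan s t = (clan_involution s == clan_involution t).
Proof.
move=> sDI tDI; have [[cs _ _] [ct _ _]] := (sDI, tDI); apply/idP/eqP.
  move=> /same_clanP[sg mt]; apply/ffunP => i; rewrite !ffunE.
  rewrite (is_num_sign (sg i)) (eq_pick (mt i)).
  by move: (sg i); case: (tnth s i) => [?||]; case: (tnth t i).
move=> e; have num i : is_num (tnth s i) = is_num (tnth t i).
  by rewrite !is_num_clan_involution // e.
apply/same_clanP; split=> [i|i j]; first by rewrite !sign_clan_involution // num e.
by rewrite !matched_clan // num e.
Qed.

Lemma card_odd_witness s : mirror_clan s ->
  count_mem Minus (take n s)
    + #|[set p : 'I_n.*2 * 'I_n.*2 | (p.1 < p.2 < n) && matched s p.1 p.2]|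
  = #|odd_witness (clan_involution s)|.
Proof.
move=> sDI; have [cs _ _] := sDI; set F := clan_involution s.
(* Witnesses sent to their mirror image are the minuses of the first half; the others are the
   smaller positions of the matched pairs inside it. *)
rewrite -(cardsID [set i | F i == rev_ord i]) count_mem_take; last by rewrite -addnn leq_addr.
congr (_ + _).
  apply: eq_card => i; rewrite !inE; case: (ltnP i n) => //= ilt.
  rewrite andb_idl; last by move=> ->.
  have := is_num_clan_involution i sDI; rewrite -/F.
  have [si /esym/andP[_ /negPf ->]|si _] := boolP (is_num (tnth s i)).
    by case: (tnth s i) si.
  rewrite /F ffunE (negPf si) ilt.
  by case: (tnth s i) si => //= _; rewrite ?eqxx // (negPf (rev_ord_neq i)).
rewrite -(card_imset (f := fun i => (i, F i))); last by move=> i j [].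
apply: eq_card => -[i j]; rewrite inE /= matched_clan // -/F.
apply/andP/imsetP => [[/andP[ij jn] /andP[si /eqP e]]|[k + [-> ->]]].
  exists i; rewrite ?e // !inE e ij jn orbT andbT (ltn_trans ij jn) andbT.
  by apply/eqP => /(congr1 val) /=; have := ltn_ord i; lia.
rewrite !inE => /and3P[/negPf kR kn]; rewrite kR /= => lt; split=> //.
rewrite eqxx andbT is_num_clan_involution // -/F kR andbT -val_eqE /=.
by case/andP: lt; lia.
Qed.

(** * From involutions back to clans *)

Definition involution_string f : n.*2.-tuple symbol :=
  [tuple if f i == i then (if i < n then Plus else Minus)
         else if f i == rev_ord i then (if i < n then Minus else Plus)
         else Defs.Num (minn i (f i)) | i < n.*2].

Lemma is_num_involution_string f i :
  is_num (tnth (involution_string f) i) = (f i != i) && (f i != rev_ord i).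
Proof. by rewrite tnth_mktuple; case: eqP => _; [|case: eqP => _ //]; case: ifP. Qed.

Lemma matched_involution_string f i j : f \in rev_involutions n.*2 ->
  matched (involution_string f) i j
  = is_num (tnth (involution_string f) i) && (f i == j).
Proof.
move=> /rev_involutionsP[fK fR]; rewrite /matched.
have [|si] := boolP (is_num (tnth (involution_string f) i)); last by rewrite andbF.
rewrite is_num_involution_string !tnth_mktuple => /andP[/negPf fi /negPf fi'].
rewrite fi fi' /=; apply/andP/eqP => [[ij]|<-].
  case: ifP => _; first by case: ifP.
  case: ifP => _; first by case: ifP.
  move=> /eqP[e]; move: ij; rewrite -val_eqE /= => ij.
  (* Labels are minima of the orbits of [f], so equal labels mean that the orbits of [i] and [j]
     meet. *)
  have: [|| i == j, i == f j, f i == j | f i == f j].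
    by rewrite -!val_eqE /=; move: e; rewrite /minn; do 2!case: ifP; lia.
  rewrite (inj_eq (can_inj fK)) -val_eqE /= (negPf ij) orbF /=.
  by move=> /orP[]/eqP; [move->; rewrite fK|].
have -> : (f (f i) == rev_ord (f i)) = false.
  by rewrite fK -(inj_eq rev_ord_inj) rev_ordK eq_sym.
by rewrite fK eq_sym fi /= minnC.
Qed.

Lemma mirror_clan_involution_string f : f \in rev_involutions n.*2 ->
  mirror_clan (involution_string f).
Proof.
move=> fS; have /rev_involutionsP[fK fR] := fS; set s := involution_string f.
have numR i : is_num (tnth s (rev_ord i)) = is_num (tnth s i).
  by rewrite !is_num_involution_string fR !(inj_eq rev_ord_inj).
have signR i : sign (tnth s (rev_ord i)) = sign (opp_symbol (tnth s i)).
  rewrite !tnth_mktuple fR !(inj_eq rev_ord_inj) rev_ord_lt_half.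
  by case: eqP => _; [|case: eqP => _ //]; case: (i < n).
split.
- apply/andP; split.
    (* Reversal is a bijection from the positions of the pluses to those of the minuses. *)
    rewrite !count_mem_tuple -(card_imset _ (@rev_ord_inj _)); apply/eqP/eq_card => i.
    rewrite -[i in LHS]rev_ordK mem_imset ?inE; last exact: rev_ord_inj.
    by have := signR i; case: (tnth s i) => [?||]; case: (tnth s _).
  apply/allP => _ /tnthP[i ->]; apply/implyP => si; rewrite count_mem_tuple.
  have -> : [set j | tnth s j == tnth s i] = [set i; f i].
    apply/setP => j; rewrite !inE; have := matched_involution_string i j fS.
    rewrite /matched -/s si eq_sym /= [f i == j]eq_sym => <-.
    by have [->|_] := eqVneq j i; rewrite ?eqxx //= eq_sym.
  by move: si; rewrite is_num_involution_string cards2 eq_sym => /andP[-> _].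
- apply/same_clanP; split=> [i|i j].
    by rewrite tnth_rev_opp -signR rev_ordK.
  rewrite matched_rev_opp !matched_involution_string // numR fR.
  by rewrite (inj_eq rev_ord_inj).
- move=> i si; have := matched_involution_string i (rev_ord i) fS.
  rewrite /matched -/s rev_ord_neq si /= => ->.
  by move: si; rewrite is_num_involution_string => /andP[].
Qed.

Lemma involution_stringK f : f \in rev_involutions n.*2 ->
  clan_involution (involution_string f) = f.
Proof.
move=> fS; have [cs _ _] := mirror_clan_involution_string fS; apply/ffunP => i.
have [si|si] := boolP (is_num (tnth (involution_string f) i)).
  apply/eqP; have := matched_involution_string i (f i) fS.
  by rewrite matched_clan // si eqxx.
rewrite ffunE (negPf si); move: si; rewrite is_num_involution_string tnth_mktuple.
have [->|_] := eqVneq (f i) i; first by case: (i < n).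
by have [->|_] := eqVneq (f i) (rev_ord i); case: (i < n).
Qed.

End ClanInvolution.

(** * Counting DIII clans, and the conclusion *)

Lemma is_DIII_clan_repr n (c : clan n) :
  reflect (mirror_clan (clan_repr c) /\ ~~ odd #|odd_witness (clan_involution (clan_repr c))|)
          (is_DIII (clan_repr c)).
Proof.
have cs : is_clan (clan_repr c) := valP (generic_quotient.repr c).
apply: (iffP and3P) => [[sR /forallP si ev]|[sDI ev]].
  have sDI : mirror_clan (clan_repr c) by split=> // i; apply/implyP.
  by rewrite -card_odd_witness.
have [_ sR si] := sDI; split=> //; last by rewrite card_odd_witness.
by apply/forallP => i; apply/implyP; apply: si.
Qed.

Lemma num_DIII_clansE n : num_DIII_clans n = #|even_rev_involutions n|.
Proof.
pose F (c : clan n) := clan_involution (clan_repr c).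
have -> : even_rev_involutions n = F @: DIII_clans n.
  apply/setP => f; rewrite inE; apply/andP/imsetP => [[fS ev]|[c + ->]]; last first.
    rewrite inE => /is_DIII_clan_repr[sDI ev]; split=> //.
    exact: clan_involution_in.
  have sDI := mirror_clan_involution_string fS; have [cs _ _] := sDI.
  pose c : clan n := (\pi_(clan n) (exist _ (involution_string f) cs))%qT.
  (* The chosen representative of [c] may carry other labels than the string, so properties are
     transported along [same_clan]. *)
  have e : same_clan (clan_repr c) (involution_string f).
    rewrite -[involution_string f]/(val (exist (@is_clan n) _ cs)).
    by rewrite -[same_clan _ _]/(clan_eq _ _) -eqmodE reprK.
  have ev' : is_DIII (clan_repr c).
    rewrite (is_DIII_same_clan e); have [_ sR si] := sDI; apply/and3P; split=> //.
      by apply/forallP => i; apply/implyP; apply: si.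
    by rewrite card_odd_witness // involution_stringK.
  exists c; first by rewrite inE.
  have [cDI _] := is_DIII_clan_repr c ev'.
  by move: e; rewrite same_clan_involution // => /eqP; rewrite /F => ->; rewrite involution_stringK.
apply/esym/card_in_imset => c d; rewrite !inE.
move=> /is_DIII_clan_repr[cDI _] /is_DIII_clan_repr[dDI _] /eqP.
rewrite -same_clan_involution // => e.
by rewrite -[c]reprK -[d]reprK; apply/eqmodP.
Qed.

Theorem theorem5p9 (n : nat) (hn : 1 <= n) :
  (exists f : {C | C \in diag_classes n.*2} -> {c | c \in DIII_clans n},
      bijective f)
  /\ num_DIII_clans n = num_diag_classes n.*2.
Proof.
have e : num_DIII_clans n = num_diag_classes n.*2.
  (* Twice either number is the cardinality of [rev_involutions n.*2]. *)
  apply/eqP; rewrite -(eqn_pmul2r (isT : 0 < 2)) num_DIII_clansE.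
  by rewrite -card_even_rev_involutions // card_rev_involutions.
by split=> //; apply: bijective_of_eq_card; rewrite !card_sig.
Qed.
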